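(* Let $k\ge 1$. (a) There are infinitely many graphs $G$ (each with the property that any $k$ vertices lie in a common cycle) such that \[ crx_k(G)-rx_k(G)=\begin{cases}3,& k=1,\\ 2,& k=2,3,\\ 1,& k\ge 4.\end{cases} \] (b) For every $c\ge 1$, there exists a graph $G$ (with the property that any $k$ vertices lie in a common cycle) such that $rx_k(G)\le k^2-1$ and $crx_k(G)\ge c$. In particular, $crx_k(G)-rx_k(G)$ can be arbitrarily large.
   Context: An edge-coloured subgraph is rainbow if its edges have distinct colours. For a graph $G$ in which any $k$ vertices lie on a common cycle, $crx_k(G)$ is the minimum number of colours in an edge-colouring of $G$ such that every set of $k$ vertices lies in some rainbow cycle. For a connected graph $G$ on $n$ vertices and $2\le k\le n$, $rx_k(G)$ (the $k$-rainbow index) is the minimum number of colours in an edge-colouring of $G$ such that any $k$ vertices are contained in a rainbow tree; by convention $rx_1(G)=0$ for every graph $G$. *)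

(* Defs.v *)
From mathcomp Require Import all_boot.
Set Implicit Arguments. Unset Strict Implicit. Unset Printing Implicit Defensive.

Section Graphs.
Variable T : finType.
Variable e : rel T.

Definition simple_graph : Prop := symmetric e /\ irreflexive e.

Definition connected_graph : Prop := forall x y : T, connect e x y.

Definition colouring_with (r : nat) (col : {set T} -> nat) : Prop :=
  forall x y, e x y -> col [set x; y] < r.

Definition is_cycle (p : seq T) : bool := [&& uniq p, 3 <= size p & cycle e p].

Definition cycle_edges (p : seq T) : seq {set T} :=
  [seq [set xy.1; xy.2] | xy <- zip p (rot 1 p)].

Definition rainbow_cycle (col : {set T} -> nat) (p : seq T) : bool :=
  is_cycle p && uniq (map col (cycle_edges p)).

Definition k_cyclable (k : nat) : Prop :=
  forall S : {set T}, #|S| = k -> exists p, is_cycle p /\ {subset S <= p}.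

Definition k_rainbow_cycle_col (k : nat) (col : {set T} -> nat) : Prop :=
  forall S : {set T}, #|S| = k -> exists p, rainbow_cycle col p /\ {subset S <= p}.

Definition sub_edges (W : {set T}) (F : {set {set T}}) : Prop :=
  forall f, f \in F -> exists x y, [/\ e x y, f = [set x; y], x \in W & y \in W].

Definition Frel (F : {set {set T}}) : rel T := fun u v => (u != v) && ([set u; v] \in F).

Definition is_tree (W : {set T}) (F : {set {set T}}) : Prop :=
  [/\ sub_edges W F, W != set0,
      (forall x y, x \in W -> y \in W -> connect (Frel F) x y) &
      (forall p : seq T, ~~ [&& uniq p, 3 <= size p & cycle (Frel F) p])].

Definition rainbow_tree (col : {set T} -> nat) (W : {set T}) (F : {set {set T}}) : Prop :=
  is_tree W F /\ {in F &, injective col}.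

Definition k_rainbow_tree_col (k : nat) (col : {set T} -> nat) : Prop :=
  forall S : {set T}, #|S| = k ->
    exists W F, rainbow_tree col W F /\ S \subset W.

Definition is_min (P : nat -> Prop) (n : nat) : Prop :=
  P n /\ forall m, P m -> n <= m.

Definition is_crx (k c : nat) : Prop :=
  is_min (fun r => exists col, colouring_with r col /\ k_rainbow_cycle_col k col) c.

(* rx_k(G) = r, with the convention rx_1 = 0 *)
Definition is_rx (k r : nat) : Prop :=
  if k == 1 then r = 0
  else is_min (fun r => exists col, colouring_with r col /\ k_rainbow_tree_col k col) r.

End Graphs.

Definition gap (k : nat) : nat :=
  if k == 1 then 3 else if k <= 3 then 2 else 1.

(* Main.v *)
Require Import Defs.
From mathcomp Require Import all_boot zify.
From Stdlib Require Import Classical_Prop.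
Set Implicit Arguments. Unset Strict Implicit. Unset Printing Implicit Defensive.

(* For (a) with k <= 2 take complete graphs: every edge lies in a rainbow
   triangle for the lexicographic powers of a 3-coloured triangle, so crx_k = 3,
   while rx_1 = 0 and rx_2 = 1. For k >= 3 take the cycle C_n: crx_k = n, and
   since a subtree meeting k vertices misses edges from only one of the arcs
   between them, rx_3 = n - 2 and rx_k = n - 1 for k >= 4.
   For (b) with k >= 2 join k hubs, which span a star, to m independent vertices.
   Colouring hub-vertex edges by the hub and the star edges with new colours gives
   rx_k <= 2k - 1 <= k^2 - 1. A cycle through k independent vertices alternates
   between them and the hubs, so k vertices that see the hubs in the same colours
   lie on no rainbow cycle; they exist by pigeonhole once m is large. *)

(** * Minima of predicates and elementary facts on finite sets *)

Lemma ex_is_min (P : nat -> Prop) n : P n -> exists2 m, is_min P m & m <= n.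
Proof.
elim/ltn_ind: n => n IH Pn.
(* [P] is arbitrary, so the existence of a smaller witness is decided classically. *)
have [[m [Pm lt_mn]]|nP] := classic (exists m, P m /\ m < n).
  by have [m' m'P le_m'm] := IH m lt_mn Pm; exists m' => //; lia.
exists n => //; split=> // m Pm; rewrite leqNgt; apply/negP => lt_mn.
by apply: nP; exists m.
Qed.

Lemma eq_set2 (T : finType) (a b x y : T) :
  [set a; b] = [set x; y] -> (a = x /\ b = y) \/ (a = y /\ b = x).
Proof.
move=> E; have aP : a \in [set x; y] by rewrite -E set21.
have bP : b \in [set x; y] by rewrite -E set22.
have xP : x \in [set a; b] by rewrite E set21.
have yP : y \in [set a; b] by rewrite E set22.
case/set2P: aP => ax; case/set2P: bP => bx; try by [left|right].
  by case/set2P: yP; [left|left]; subst.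
by case/set2P: xP; [right|right]; subst.
Qed.

Lemma set_extend (T : finType) (A : {set T}) k :
  #|A| <= k <= #|T| -> exists2 B : {set T}, A \subset B & #|B| = k.
Proof.
case/andP=> leAk; elim: k leAk => [|k IH] leAk lekT.
  by exists A => //; lia.
have [eqA|neA] := eqVneq #|A| k.+1; first by exists A.
have [|B sAB cB] := IH _ (ltnW lekT); first by lia.
have /card_gt0P[x] : 0 < #|~: B| by move: (cardsC B); lia.
rewrite inE => xB; exists (x |: B); first by rewrite subsetU // sAB orbT.
by rewrite cardsU1 xB cB.
Qed.

Section Colour.
Variables (T : finType) (c : T -> T -> nat).

(** [pick] orders the two ends of an edge arbitrarily; a symmetric [c] makes the choice
    immaterial. *)
Definition edge_col (A : {set T}) : nat :=
  if [pick u | A == [set u.1; u.2]] is Some u then c u.1 u.2 else 0.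

Lemma edge_colE (csym : forall x y, c x y = c y x) x y :
  edge_col [set x; y] = c x y.
Proof.
rewrite /edge_col; case: pickP => [[a b] /= /eqP/eq_set2[]|/(_ (x, y))/=].
- by case=> -> ->.
- by case=> -> ->.
by rewrite eqxx.
Qed.

End Colour.

(** * Cycles and rainbow trees in an arbitrary graph *)

Section Cycles.
Variables (T : finType) (e : rel T).
Implicit Type p : seq T.

(** Turns the rotation in [cycle_edges] into [next], so that the edges of a cycle are indexed by its
    vertices. *)
Lemma map_next_rot p : uniq p -> map (next p) p = rot 1 p.
Proof.
case: p => [//|y p] Up; apply: (@eq_from_nth _ y).
  by rewrite size_map size_rot.
move=> i; rewrite size_map => lti; rewrite (nth_map y) // next_nth mem_nth //.
rewrite index_uniq // rot1_cons nth_rcons; case: ltngtP => //= [lt_pi|->].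
  by move: lti => /=; lia.
by rewrite nth_default.
Qed.

Lemma cycle_edgesE p :
  uniq p -> cycle_edges p = [seq [set x; next p x] | x <- p].
Proof.
move=> Up; rewrite /cycle_edges -map_next_rot //.
by move: (next p) => f; elim: p {Up} => //= x q ->.
Qed.

Lemma size_cycle_edges p : uniq p -> size (cycle_edges p) = size p.
Proof. by move=> Up; rewrite cycle_edgesE // size_map. Qed.

Lemma next_next_neq p x : uniq p -> 3 <= size p -> x \in p ->
  next p (next p x) != x.
Proof.
move=> Up sp xp; have [i q Eq] := rot_to xp.
rewrite -!(next_rot i Up) Eq.
have : uniq (x :: q) by rewrite -Eq rot_uniq.
have : size (x :: q) = size p by rewrite -Eq size_rot.
case: q {Eq} => [|y [|z q]] /=; [by lia|by lia|move=> _].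
rewrite !inE !negb_or eqxx /= -!andbA => /and5P[nxy nxz _ _ _].
by rewrite eq_sym (eq_sym y) (negPf nxy) eqxx.
Qed.

Lemma next_neq_prev p x : uniq p -> 3 <= size p -> x \in p ->
  next p x != prev p x.
Proof.
move=> Up sp xp; apply/eqP => E; have := next_next_neq Up sp xp.
by rewrite E next_prev // eqxx.
Qed.

(** Two vertices could yield the same edge only by following each other, which needs a cycle of
    length 2. *)
Lemma uniq_cycle_edges p : uniq p -> 3 <= size p -> uniq (cycle_edges p).
Proof.
move=> Up sp; rewrite cycle_edgesE // map_inj_in_uniq // => x y xp yp.
case/eq_set2=> [[] //|[Ex Ey]].
by have := next_next_neq Up sp xp; rewrite Ey -Ex eqxx.
Qed.

Lemma rainbow_cycle_size col r p :
  colouring_with e r col -> rainbow_cycle e col p -> size p <= r.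
Proof.
move=> colr /andP[/and3P[Up _ cp] Ucol].
rewrite -(size_cycle_edges Up) -(size_map col) -(size_iota 0 r).
apply: uniq_leq_size => // _ /mapP[f + ->].
rewrite cycle_edgesE // => /mapP[x xp ->].
by rewrite mem_iota add0n colr // (next_cycle cp).
Qed.

Lemma rainbow_cyclable k col :
  k_rainbow_cycle_col e k col -> k_cyclable e k.
Proof.
by move=> H S /H[p [/andP[cp _] sSp]]; exists p.
Qed.

(** Giving every vertex set its own colour makes all cycles rainbow, so some number of colours
    suffices. *)
Lemma ex_is_crx k : k_cyclable e k -> exists c, is_crx e k c.
Proof.
move=> H; pose col (A : {set T}) : nat := enum_rank A.
case: (@ex_is_min (fun r => exists col, colouring_with e r col /\
          k_rainbow_cycle_col e k col) #|{set T}|).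
- exists col; split=> [x y _|S /H[p [cp sSp]]]; first exact: ltn_ord.
  exists p; split=> //; rewrite /rainbow_cycle cp /=.
  case/and3P: cp => Up sp _; rewrite map_inj_uniq ?uniq_cycle_edges //.
  by move=> A B /val_inj/enum_rank_inj.
by move=> c cP _; exists c.
Qed.

(* A vertex of maximal rank on a cycle would have both its neighbours equal to
   its parent. *)
Lemma rainbow_parent_tree col (W : {set T}) root (par : T -> T) (rank : T -> nat) :
  root \in W ->
  (forall x, x \in W -> x != root ->
     [/\ par x \in W, e x (par x) & rank (par x) < rank x]) ->
  {in W :\ root &, injective (fun x => col [set x; par x])} ->
  rainbow_tree e col W [set [set x; par x] | x in W :\ root].
Proof.
move=> rW parP cinj; set F := imset _ _.
have Fpar x : x \in W -> x != root -> Frel F x (par x).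
  move=> xW xr; have [_ _ rk] := parP x xW xr.
  rewrite /Frel; apply/andP; split; first by apply: contraTneq rk => <-; lia.
  by apply/imsetP; exists x; rewrite // !inE xr.
have Fsym : symmetric (Frel F) by move=> x y; rewrite /Frel eq_sym setUC.
have FE x y : Frel F x y -> x \in W /\ y \in W /\
    ((y = par x /\ rank y < rank x) \/ (x = par y /\ rank x < rank y)).
  case/andP=> _ /imsetP[z]; rewrite !inE => /andP[zr zW].
  have [pW _ rk] := parP z zW zr.
  by case/eq_set2=> [[-> ->]|[-> ->]]; (split; [|split]) => //; [left|right].
have croot x : x \in W -> connect (Frel F) x root.
  have [n] := ubnP (rank x); elim: n x => // n IH x lt_n xW.
  have [->|xr] := eqVneq x root; first exact: connect0.
  have [pW _ rk] := parP x xW xr.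
  apply: connect_trans (connect1 (Fpar x xW xr)) (IH _ _ pW); lia.
split; last first.
  move=> _ _ /imsetP[x xW ->] /imsetP[y yW ->] E.
  by rewrite (cinj x y xW yW E).
split.
- move=> _ /imsetP[x + ->]; rewrite !inE => /andP[xr xW].
  by have [pW exp _] := parP x xW xr; exists x, (par x).
- by apply/set0Pn; exists root.
- move=> x y xW yW; apply: connect_trans (croot x xW) _.
  by rewrite sym_connect_sym ?croot.
move=> p; apply/negP => /and3P[Up sp cp].
case: p => [//|x0 p] in Up sp cp *.
have [x xp xmax] :=
  @arg_maxnP T x0 (fun y => y \in x0 :: p) rank (mem_head x0 p).
have := next_neq_prev Up sp xp.
have /FE[_ [_ [[-> _]|[_]]]] := next_cycle cp xp; last first.
  by have := xmax (next (x0 :: p) x); rewrite mem_next => /(_ xp); lia.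
have /FE[_ [_ [[_]|[-> _]]]] := prev_cycle cp xp; last by rewrite eqxx.
by have := xmax (prev (x0 :: p) x); rewrite mem_prev => /(_ xp); lia.
Qed.

End Cycles.

(** * Complete graphs *)

Definition neq_rel (T : finType) : rel T := fun x y => x != y.

Definition every_edge_in_rainbow_triangle (T : finType) (c : T -> T -> nat) :=
  forall x y, x != y ->
    exists z, [/\ z != x, z != y & uniq [:: c x y; c y z; c z x]].

(* Lexicographic powers of a triangle with three distinct edge colours. *)
Lemma ex_rainbow_triangle_colouring N :
  exists (T : finType) (c : T -> T -> nat),
    [/\ N < #|T|, forall x y, c x y = c y x, forall x y, c x y < 3
      & every_edge_in_rainbow_triangle c].
Proof.
elim: N => [|N [T [c [ltN csym c3 ctri]]]].
  exists unit, (fun _ _ => 0).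
  by split; rewrite ?card_unit // => -[] [].
(* Each vertex becomes a triangle whose edges get the distinct sums 1, 2 and 3 modulo 3; edges
   between triangles inherit the old colours. *)
pose c' (u v : T * 'I_3) := if u.1 == v.1 then (u.2 + v.2) %% 3 else c u.1 v.1.
exists (T * 'I_3)%type, c'; split.
- by rewrite card_prod card_ord; lia.
- by move=> u v; rewrite /c' eq_sym addnC csym.
- by move=> u v; rewrite /c'; case: ifP => // _; rewrite ltn_mod.
move=> [x a] [y b]; rewrite /c' /= xpair_eqE.
have [<-|nxy] := eqVneq x y; last first.
  move=> _; have [z [nzx nzy Uc]] := ctri x y nxy.
  exists (z, a) => /=; rewrite !xpair_eqE (negPf nzx) (negPf nzy).
  by rewrite (eq_sym y) (negPf nzy).
(* As [a] and [b] differ, [3 - (a + b)] is the third element of ['I_3]. *)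
move=> /= nab; exists (x, inord (3 - (a + b))) => /=.
rewrite !xpair_eqE !eqxx /=.
by case: a b nab => [[|[|[|//]]] ?] [[|[|[|//]]] ?] //= _;
   split; rewrite -?val_eqE /= ?inordK.
Qed.

Section Complete.
Variables (T : finType) (c : T -> T -> nat).
Hypotheses (csym : forall x y, c x y = c y x) (c3 : forall x y, c x y < 3).
Hypotheses (ctri : every_edge_in_rainbow_triangle c) (T2 : 1 < #|T|).

Lemma complete_rainbow_cycle (x y : T) : x != y ->
  exists p, rainbow_cycle (@neq_rel T) (edge_col c) p /\ x \in p /\ y \in p.
Proof.
move=> nxy; have [z [nzx nzy Uc]] := ctri nxy.
exists [:: x; y; z]; rewrite !inE !eqxx orbT; split=> //.
rewrite /rainbow_cycle /cycle_edges [map _ _]/= !edge_colE // Uc andbT.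
by rewrite /is_cycle /neq_rel /= !inE (eq_sym x z) (eq_sym y z) !(negPf nxy, negPf nzx, negPf nzy).
Qed.

Lemma complete_rainbow_cycle_col k : 0 < k <= 2 ->
  k_rainbow_cycle_col (@neq_rel T) k (edge_col c).
Proof.
move=> k12 S Sk.
have [B sSB /eqP/cards2P[x [y [nxy EB]]]] : exists2 B : {set T}, S \subset B & #|B| = 2.
  by apply: set_extend; lia.
have [p [cp [xp yp]]] := complete_rainbow_cycle nxy.
exists p; split=> // u /(subsetP sSB); rewrite EB.
by case/set2P=> ->.
Qed.

Lemma complete_is_crx k : 0 < k <= 2 -> is_crx (@neq_rel T) k 3.
Proof.
move=> k12; split.
  exists (edge_col c); split; last exact: complete_rainbow_cycle_col.
  by move=> x y _; rewrite edge_colE.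
move=> r [col [colr colc]].
have [S _ Sk] : exists2 S : {set T}, set0 \subset S & #|S| = k.
  by apply: set_extend; rewrite cards0; lia.
have [p [cp _]] := colc S Sk.
apply: leq_trans (rainbow_cycle_size colr cp).
by case/andP: cp => /and3P[].
Qed.

Lemma complete_is_rx2 : is_rx (@neq_rel T) 2 1.
Proof.
split.
  exists (fun=> 0); split=> // S /eqP/cards2P[x [y [nxy ->]]].
  exists [set x; y], [set [set z; x] | z in [set x; y] :\ x]; split=> //.
  apply: (@rainbow_parent_tree _ _ _ _ x (fun=> x) (fun z => z != x)).
  - exact: set21.
  - by move=> z _ zx; rewrite set21 eqxx zx.
  by move=> u v; rewrite !inE => /andP[/negPf-> /eqP->] /andP[/negPf-> /eqP->].
move=> [|//] [col [colr _]].
by have /card_gt1P[x [y [_ _ /colr]]] := T2.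
Qed.

Lemma complete_graphP k : 0 < k <= 2 ->
  [/\ simple_graph (@neq_rel T), connected_graph (@neq_rel T)
    & k_cyclable (@neq_rel T) k].
Proof.
move=> k12; split.
- by split=> [x y|x]; rewrite /neq_rel ?eqxx // eq_sym.
- move=> x y; have [->|nxy] := eqVneq x y; first exact: connect0.
  exact: connect1.
exact: rainbow_cyclable (complete_rainbow_cycle_col k12).
Qed.

End Complete.

Lemma gap_le2 k N : 0 < k <= 2 -> exists (T : finType) (e : rel T),
  N <= #|T| /\ [/\ k <= #|T|, simple_graph e, connected_graph e, k_cyclable e k
    & exists r c, [/\ is_rx e k r, is_crx e k c & c = r + gap k]].
Proof.
move=> k12.
have [T [c [ltN csym c3 ctri]]] := ex_rainbow_triangle_colouring (N + 2).
have T2 : 1 < #|T| by lia.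
exists T, (@neq_rel T); split; first by lia.
have [] := complete_graphP csym ctri T2 k12; split=> //; first by lia.
have := complete_is_crx csym c3 ctri T2 k12.
have [->|->] : k = 1 \/ k = 2 by lia.
- by exists 0, 3.
by exists 1, 3; split=> //; exact: complete_is_rx2.
Qed.

(** * Values of the cyclic successor and predecessor *)

Lemma val_ordS n (x : 'I_n.+1) :
  ordS x = (if x == n :> nat then 0 else x.+1) :> nat.
Proof.
case: x => x ltx /=; case: eqP => [->|nx]; first by rewrite modnn.
by rewrite modn_small; lia.
Qed.

Lemma val_ord_pred n (x : 'I_n.+1) : 0 < x -> ord_pred x = x.-1 :> nat.
Proof.
case: x => x ltx /= x0.
have -> : (x + n.+1).-1 = x.-1 + n.+1 by lia.
by rewrite modnDr modn_small; lia.
Qed.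

(** * Cycles *)

Section CycleGraph.
Variable m : nat.
Local Notation n := m.+4.
Implicit Types x y : 'I_n.

Definition cycle_rel : rel 'I_n := fun x y => (y == ordS x) || (x == ordS y).

(** Naming each edge by the end it leaves in the direction of [ordS] turns colourings of the cycle
    into functions on ['I_n]. *)
Definition cedge x : {set 'I_n} := [set x; ordS x].

Lemma ordS_ordS_neq x : ordS (ordS x) <> x.
Proof.
move/(congr1 (@nat_of_ord _)); rewrite val_ordS.
by rewrite val_ordS; case: ifP; case: ifP; have := ltn_ord x; lia.
Qed.

Lemma cedge_inj : injective cedge.
Proof.
move=> x y /eq_set2[[]//|[-> E]].
by case: (@ordS_ordS_neq y).
Qed.

Lemma cycle_relP x y :
  cycle_rel x y -> exists2 z, [set x; y] = cedge z & z = x \/ z = y.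
Proof.
case/orP=> /eqP->; first by exists x => //; left.
by exists y; [rewrite setUC|right].
Qed.

Lemma cycle_rel_sym : symmetric cycle_rel.
Proof. by move=> x y; rewrite /cycle_rel orbC. Qed.

Lemma cycle_relS x : cycle_rel x (ordS x).
Proof. by rewrite /cycle_rel eqxx. Qed.

Lemma cycle_rel_simple : simple_graph cycle_rel.
Proof.
split=> [|x]; first exact: cycle_rel_sym.
apply/negP; rewrite /cycle_rel orbb => /eqP E.
by case: (@ordS_ordS_neq x); rewrite -!E.
Qed.

(** The two neighbours of a vertex along [p] are distinct, so one of them is its [ordS]; hence [p]
    is closed under [ordS]. *)
Lemma cycle_rel_cover p : is_cycle cycle_rel p -> forall x, x \in p.
Proof.
case/and3P=> Up sp cp.
have pS x : x \in p -> ordS x \in p.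
  move=> xp; have := next_neq_prev Up sp xp.
  have /orP[/eqP<-|/eqP Ex] := next_cycle cp xp; first by rewrite mem_next.
  have /orP[/eqP Ex'|/eqP<-] := prev_cycle cp xp; last by rewrite mem_prev.
  by case/eqP; apply: ordS_inj; rewrite -Ex -Ex'.
have p0 : ord0 \in p.
  case: p sp pS {Up cp} => // z p _ pS.
  have step d : d <= n -> iter d (@ordS n) z \in z :: p.
    by elim: d => [|d IH] lt_d; [exact: mem_head|apply/pS/IH/ltnW].
  have iterE d : iter d (@ordS n) z = (z + d) %% n :> nat.
    elim: d => [|d /= ->]; first by rewrite addn0 modn_small.
    by rewrite -addn1 modnDml addn1 addnS.
  (* From [z], exactly [n - z] steps forward wrap around to 0. *)
  have -> : ord0 = iter (n - z) (@ordS n) z.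
    by apply: ord_inj; rewrite iterE subnKC ?modnn // ltnW.
  by apply: step; exact: leq_subr.
move=> [i lti]; elim: i lti => [|i IH] lti.
  by have -> : Ordinal lti = ord0 by exact: val_inj.
have lti' : i < n by lia.
have -> : Ordinal lti = ordS (Ordinal lti'); last exact/pS/IH.
apply: ord_inj; rewrite val_ordS /=; case: eqP => //; lia.
Qed.

Definition cedge_col (G : 'I_n -> nat) (A : {set 'I_n}) : nat :=
  if [pick i | A == cedge i] is Some i then G i else 0.

Lemma cedge_colE G i : cedge_col G (cedge i) = G i.
Proof.
rewrite /cedge_col; case: pickP => [j /eqP/cedge_inj-> //|/(_ i)].
by rewrite eqxx.
Qed.

Lemma cedge_colouring r G : (forall i, G i < r) ->
  colouring_with cycle_rel r (cedge_col G).
Proof. by move=> Gr x y /cycle_relP[z -> _]; rewrite cedge_colE. Qed.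

Lemma enum_cycle : is_cycle cycle_rel (enum 'I_n).
Proof.
rewrite /is_cycle enum_uniq size_enum_ord /=.
have -> : enum 'I_n = traject (@ordS n) ord0 n.
  apply: (@eq_from_nth _ ord0); rewrite ?size_traject ?size_enum_ord // => i lti.
  rewrite nth_traject //; apply: ord_inj; rewrite nth_enum_ord //=.
  elim: i lti => [//|i IH] lti; rewrite iterS val_ordS -IH; last by lia.
  by case: eqP => //; lia.
rewrite /= rcons_path; apply/andP; split.
  apply: (@sub_path _ (frel (@ordS n))) (fpath_traject _ _ _).
  by move=> x y /= /eqP<-; exact: cycle_relS.
rewrite last_traject; apply/orP; left; apply/eqP/ord_inj.
have iterE d : d < n -> iter d (@ordS n) ord0 = d :> nat.
  elim: d => [//|i IH] lti; rewrite iterS val_ordS IH; last by lia.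
  by case: eqP => //; lia.
by rewrite val_ordS -!iterSr iterE ?eqxx.
Qed.

Lemma cycle_cyclable k : k_cyclable cycle_rel k.
Proof.
by move=> S _; exists (enum 'I_n); split=> [|x _]; rewrite ?enum_cycle ?mem_enum.
Qed.

Lemma cycle_connected : connected_graph cycle_rel.
Proof.
have /and3P[_ _ cp] := enum_cycle.
by move=> x y; apply: (connect_cycle cp); rewrite mem_enum.
Qed.

(** Distinct colours on all edges suffice; conversely every cycle is Hamiltonian, so a rainbow one
    uses [n] colours. *)
Lemma cycle_is_crx k : k <= n -> is_crx cycle_rel k n.
Proof.
move=> kn; split.
  exists (cedge_col (@nat_of_ord n)); split.
    exact: cedge_colouring.
  move=> S _; exists (enum 'I_n); split=> [|x _]; last by rewrite mem_enum.
  rewrite /rainbow_cycle enum_cycle /=.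
  have /and3P[Up sp cp] := enum_cycle.
  rewrite map_inj_in_uniq ?uniq_cycle_edges // => A B.
  rewrite cycle_edgesE // => /mapP[x xp ->] /mapP[y yp ->].
  have /cycle_relP[u -> _] := next_cycle cp xp.
  have /cycle_relP[v -> _] := next_cycle cp yp.
  by rewrite !cedge_colE => /val_inj->.
move=> r [col [colr colc]].
have [S _ Sk] : exists2 S : {set 'I_n}, set0 \subset S & #|S| = k.
  by apply: set_extend; rewrite cards0 card_ord; lia.
have [p [cp _]] := colc S Sk.
apply: leq_trans (rainbow_cycle_size colr cp).
rewrite -[leqLHS](size_enum_ord n); apply: uniq_leq_size (enum_uniq _) _.
by move=> x _; apply: cycle_rel_cover; case/andP: cp.
Qed.

(* If the edges [i, i+1] and [j, j+1] are missing, no edge leaves (i, j]. *)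
Lemma two_missing_edges (W : {set 'I_n}) F (i j u v : 'I_n) :
  is_tree cycle_rel W F -> u \in W -> v \in W ->
  i < u <= j -> ~~ (i < v <= j) -> (cedge i \in F) || (cedge j \in F).
Proof.
case=> sF _ conn _ uW vW ui vi; apply/norP => -[iF jF].
have cl : closed (Frel F) [pred x : 'I_n | i < x <= j].
  apply: (intro_closed (sym_connect_sym _)).
    by move=> x y; rewrite /Frel eq_sym setUC.
  move=> x y /andP[_ xyF]; rewrite !inE => xi.
  have [x' [y' [exy' Exy _ _]]] := sF _ xyF.
  have [z Ez _] := cycle_relP exy'; rewrite Exy Ez in xyF.
  have zi : z <> i by move=> E; rewrite -E xyF in iF.
  have zj : z <> j by move=> E; rewrite -E xyF in jF.
  have zi' : z <> i :> nat by move/val_inj.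
  have zj' : z <> j :> nat by move/val_inj.
  have := ltn_ord j.
  have /eq_set2[[Ex Ey]|[Ex Ey]] : [set x; y] = [set z; ordS z] by rewrite Exy Ez.
    by move: xi; rewrite Ex Ey val_ordS; case: eqP; lia.
  by move: xi; rewrite Ex Ey val_ordS; case: eqP; lia.
have := closed_connect cl (conn u v uW vW); rewrite !inE ui.
by move/esym; apply/negP.
Qed.

(** The arc from the smaller index, exclusive, to the larger one separates [i] from [j], and both
    lie in the tree. *)
Lemma two_missing_in (W : {set 'I_n}) F (S : {set 'I_n}) (i j : 'I_n) :
  is_tree cycle_rel W F -> S \subset W -> i \in S -> j \in S -> i != j ->
  (cedge i \in F) || (cedge j \in F).
Proof.
move=> tF /subsetP sSW iS jS; rewrite -val_eqE /=.
case: ltngtP => // [lt_ij|lt_ji] _.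
  by apply: (two_missing_edges tF (sSW j jS) (sSW i iS)); lia.
by rewrite orbC; apply: (two_missing_edges tF (sSW i iS) (sSW j jS)); lia.
Qed.

End CycleGraph.

(* [h] sends an element to a chosen representative of its fibre, and [X] is the
   set of non-representatives. *)
Lemma ex_repetitions (T : finType) (g : T -> nat) r : (forall x, g x < r) ->
  exists (X : {set T}) (h : T -> T), #|T| <= r + #|X| /\
    forall x, x \in X -> g (h x) = g x /\ h x \notin X.
Proof.
move=> gr; pose h x := odflt x [pick y | g y == g x].
have gh x : g (h x) = g x by rewrite /h; case: pickP => //= y /eqP.
have hg x y : g x = g y -> h x = h y.
  by rewrite /h => ->; case: pickP => //= /(_ y); rewrite eqxx.
have hh x : h (h x) = h x by apply: hg.
exists [set x | h x != x], h; split; last first.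
  by move=> x _; rewrite inE hh eqxx.
rewrite -(cardsC [set x | h x != x]) addnC leq_add2r.
(* Distinct representatives have distinct values under [g], so there are at most [r] of them. *)
rewrite -[leqRHS]card_ord -(@card_in_imset _ _ (fun x => Ordinal (gr x))).
  exact: max_card.
move=> x y; rewrite !inE !negbK => /eqP Ex /eqP Ey /(congr1 val) /= /hg.
by rewrite Ex Ey.
Qed.

Lemma cards4_le (T : finType) (a b c d : T) : #|[set a; b; c; d]| <= 4.
Proof.
rewrite -!setUA !cardsU1 cards1.
by case: (_ \notin _); case: (_ \notin _); case: (_ \notin _).
Qed.

(** * Lower bound for the rainbow index of a cycle *)

Section CycleLower.
Variables (m r : nat) (col : {set 'I_m.+4} -> nat).
Local Notation n := m.+4.
Hypothesis colr : colouring_with (@cycle_rel m) r col.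

Let g (i : 'I_n) := col (cedge i).

Lemma cedge_col_lt i : g i < r.
Proof. by apply: colr; exact: cycle_relS. Qed.

Lemma rainbow_tree_inj W F (i j : 'I_n) :
  rainbow_tree (@cycle_rel m) col W F -> cedge i \in F -> cedge j \in F ->
  g i = g j -> i = j.
Proof. by case=> _ injF iF jF E; apply: (@cedge_inj m); exact: injF. Qed.

(* At most one edge [cedge i] with [i] in [S] is missing from the tree. *)
Lemma no_two_repetitions (S : {set 'I_n}) W F (x1 x2 y1 y2 : 'I_n) :
  rainbow_tree (@cycle_rel m) col W F -> S \subset W ->
  [/\ x1 \in S, x2 \in S, y1 \in S & y2 \in S] ->
  g y1 = g x1 -> g y2 = g x2 ->
  [/\ x1 != x2, x1 != y1, x1 != y2, x2 != y1 & x2 != y2] -> False.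
Proof.
move=> rt sSW [x1S x2S y1S y2S] E1 E2 [x12 x1y1 x1y2 x2y1 x2y2].
have two i j : i \in S -> j \in S -> i != j -> (cedge i \in F) || (cedge j \in F).
  by move=> iS jS; apply: two_missing_in rt.1 sSW iS jS.
have inj i j : i != j -> g i = g j -> cedge i \in F -> cedge j \in F -> False.
  by move=> nij Eg iF jF; rewrite (rainbow_tree_inj rt iF jF Eg) eqxx in nij.
have i1 := inj _ _ x1y1 (esym E1); have i2 := inj _ _ x2y2 (esym E2).
have t1 := two _ _ x1S x2S x12; have t2 := two _ _ x1S y2S x1y2.
have t3 := two _ _ x2S y1S x2y1.
(* If [y1] and [y2] differ, each of the two disjoint pairs misses an edge; if they coincide, three
   edges share a colour and two of them are missing. *)
have [Ey|ny] := eqVneq y1 y2; last first.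
  have t4 := two _ _ y1S y2S ny.
  by case: (cedge x1 \in F) i1 t1 t2; case: (cedge x2 \in F) i2 t3 t4;
     case: (cedge y1 \in F); case: (cedge y2 \in F) => /=; intuition.
have i3 := inj _ _ x12; rewrite -E1 -E2 Ey in i3.
move: i1 i2 i3 t1 t2 t3; rewrite Ey.
by case: (cedge x1 \in F); case: (cedge x2 \in F);
   case: (cedge y2 \in F) => /=; intuition.
Qed.

(* The second, fourth and sixth of six edges in cyclic order cut the cycle into
   three arcs, each containing two of the six; a tree through the three cut
   vertices can only miss edges of one arc, so it contains four of the six. *)
Lemma no_six_edges_three_colours (q : seq 'I_n) (L : seq nat) :
  k_rainbow_tree_col (@cycle_rel m) 3 col ->
  uniq q -> size q = 6 -> size L <= 3 -> ~ (forall x, x \in q -> g x \in L).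
Proof.
move=> rtc.
wlog sq : q / sorted (relpre (@nat_of_ord n) leq) q.
  move=> H Uq q6 L3 gL; apply: (H (sort (relpre (@nat_of_ord n) leq) q)) => //.
  - by apply: sort_sorted => x y; exact: leq_total.
  - by rewrite sort_uniq.
  - by rewrite size_sort.
  by move=> x; rewrite mem_sort; exact: gL.
move=> Uq q6 L3 gL.
have {}sq : sorted ltn (map (@nat_of_ord n) q).
  rewrite ltn_sorted_uniq_leq map_inj_uniq; last exact: ord_inj.
  by rewrite Uq sorted_map.
case: q Uq q6 gL sq => [|p1 [|p2 [|p3 [|p4 [|p5 [|p6 [|//]]]]]]] // Uq _ gL.
move=> /= /and5P[l1 l2 l3 l4 /andP[l5 _]].
have S3 : #|[set p2; p4; p6]| = 3.
  rewrite -setUA cardsU1 cards2 !inE negb_or.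
  have -> : p2 != p4 by rewrite -val_eqE /=; clear -l1 l2 l3 l4 l5; lia.
  have -> : p2 != p6 by rewrite -val_eqE /=; clear -l1 l2 l3 l4 l5; lia.
  by have -> : p4 != p6 by rewrite -val_eqE /=; clear -l4 l5; lia.
have [W [F [rt /subsetP sSW]]] := rtc _ S3.
have p2W : p2 \in W by apply: sSW; rewrite !inE eqxx.
have p4W : p4 \in W by apply: sSW; rewrite !inE eqxx orbT.
have p6W : p6 \in W by apply: sSW; rewrite !inE eqxx !orbT.
have miss (i j u v : 'I_n) : u \in W -> v \in W -> i < u <= j -> ~~ (i < v <= j) ->
  (cedge i \in F) || (cedge j \in F) by exact: two_missing_edges rt.1.
pose b x := cedge x \in F.
(* The three arcs carry the pairs [p2 p3], [p4 p5] and [p6 p1]; each of the other twelve pairs has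
   an edge in the tree. *)
have s4 : 4 <= size (filter b [:: p1; p2; p3; p4; p5; p6]).
  have t12 : b p1 || b p2 by apply: (miss _ _ p2 p4) => //; clear -l1 l2 l3 l4 l5; lia.
  have t13 : b p1 || b p3 by apply: (miss _ _ p2 p4) => //; clear -l1 l2 l3 l4 l5; lia.
  have t14 : b p1 || b p4 by apply: (miss _ _ p2 p6) => //; clear -l1 l2 l3 l4 l5; lia.
  have t15 : b p1 || b p5 by apply: (miss _ _ p2 p6) => //; clear -l1 l2 l3 l4 l5; lia.
  have t24 : b p2 || b p4 by apply: (miss _ _ p4 p6) => //; clear -l1 l2 l3 l4 l5; lia.
  have t25 : b p2 || b p5 by apply: (miss _ _ p4 p6) => //; clear -l1 l2 l3 l4 l5; lia.
  have t26 : b p2 || b p6 by apply: (miss _ _ p4 p2) => //; clear -l1 l2 l3 l4 l5; lia.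
  have t34 : b p3 || b p4 by apply: (miss _ _ p4 p6) => //; clear -l1 l2 l3 l4 l5; lia.
  have t35 : b p3 || b p5 by apply: (miss _ _ p4 p6) => //; clear -l1 l2 l3 l4 l5; lia.
  have t36 : b p3 || b p6 by apply: (miss _ _ p4 p2) => //; clear -l1 l2 l3 l4 l5; lia.
  have t46 : b p4 || b p6 by apply: (miss _ _ p6 p2) => //; clear -l1 l2 l3 l4 l5; lia.
  have t56 : b p5 || b p6 by apply: (miss _ _ p6 p2) => //; clear -l1 l2 l3 l4 l5; lia.
  rewrite size_filter /=.
  move: t12 t13 t14 t15 t24 t25 t26 t34 t35 t36 t46 t56.
  by case: (b p1); case: (b p2); case: (b p3); case: (b p4); case: (b p5);
     case: (b p6).
have : size (map g (filter b [:: p1; p2; p3; p4; p5; p6])) <= size L.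
  apply: uniq_leq_size.
    rewrite map_inj_in_uniq ?filter_uniq // => x y.
    rewrite !mem_filter => /andP[xF _] /andP[yF _]; exact: rainbow_tree_inj rt xF yF.
  by move=> _ /mapP[x + ->]; rewrite mem_filter => /andP[_ /gL].
by rewrite size_map; lia.
Qed.

(** Too few colours leave two repetitions, or three if [k = 3]. Two repetitions involve at most four
    vertices, which settles [k >= 4]. For [k = 3], two with a common representative involve only
    three vertices; otherwise six edges share at most three colours. *)
Lemma cycle_rx_lower k : 3 <= k <= n ->
  k_rainbow_tree_col (@cycle_rel m) k col -> (n <= r + 1 + (k == 3)).
Proof.
move=> k3n rtc; rewrite leqNgt; apply/negP => lt_r.
have [X [h [cX hP]]] := ex_repetitions cedge_col_lt.
rewrite card_ord in cX.
have neq x y : x \in X -> y \in X -> x != h y.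
  by move=> xX /hP[_]; apply: contraNneq => <-.
have gh x : x \in X -> g (h x) = g x by case/hP.
have bad (x1 x2 : 'I_n) : x1 \in X -> x2 \in X -> x1 != x2 ->
    #|[set x1; x2; h x1; h x2]| <= k -> False.
  move=> x1X x2X x12 cS.
  have [|S sS cSk] := @set_extend _ [set x1; x2; h x1; h x2] k.
    by rewrite cS card_ord; lia.
  have [W [F [rt sSW]]] := rtc S cSk.
  apply: (no_two_repetitions rt sSW _ (gh _ x1X) (gh _ x2X)).
    by split; apply: (subsetP sS); rewrite !inE eqxx ?orbT.
  by rewrite !neq.
have [k3|nk3] := eqVneq k 3; last first.
  have /card_gt1P[u1 [u2 [u1X u2X u12]]] : 1 < #|X| by lia.
  by apply: (bad u1 u2) => //; apply: leq_trans (cards4_le _ _ _ _) _; lia.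
have /card_gt2P[u1 [u2 [u3 [[u1X u2X u3X] [u12 u23 u31]]]]] : 2 < #|X| by lia.
have hneq u v : u \in X -> v \in X -> u != v -> h u != h v.
  move=> uX vX uv; apply/eqP => Eh; apply: (bad u v) => //.
  rewrite Eh -setUA setUid -setUA k3 !cardsU1 cards1.
  by case: (_ \notin _); case: (_ \notin _).
rewrite k3 in rtc.
apply: (no_six_edges_three_colours (q := [:: u1; u2; u3; h u1; h u2; h u3])
          (L := [:: g u1; g u2; g u3]) rtc) => //.
  have u13 : u1 != u3 by rewrite eq_sym.
  by rewrite /= !inE !negb_or !hneq // !neq // u12 u23 u13.
move=> x; rewrite !inE => /or4P[/eqP->|/eqP->|/eqP->|];
  rewrite ?eqxx ?orbT // => /or3P[] /eqP->; by rewrite gh ?eqxx ?orbT.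
Qed.

End CycleLower.

(** * Upper bounds for the rainbow index of a cycle *)

Section CycleUpper.
Variable m : nat.
Local Notation n := m.+4.
Implicit Types x y : 'I_n.

Lemma pred_edge x : 0 < x -> [set x; ord_pred x] = cedge (ord_pred x).
Proof. by move=> x0; rewrite /cedge ord_predK setUC. Qed.

Lemma cycle_rel_pred x : cycle_rel x (ord_pred x).
Proof. by rewrite /cycle_rel ord_predK eqxx orbT. Qed.

(** The spanning path without the edge from [n - 1] to 0 serves every set. The cap in [G] makes only
    that last edge repeat a colour. *)
Lemma cycle_rx_upper_gt3 k : 
  exists col, colouring_with (@cycle_rel m) n.-1 col /\
              k_rainbow_tree_col (@cycle_rel m) k col.
Proof.
pose G (i : 'I_n) := minn i m.+2.
exists (cedge_col G); split.
  by apply: cedge_colouring => i; rewrite /G /=; lia.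
move=> S _; exists setT, [set [set x; ord_pred x] | x in [set: 'I_n] :\ ord0].
split; last exact: subsetT.
have x0 x : x != ord0 -> 0 < x by rewrite lt0n.
apply: (rainbow_parent_tree (rank := @nat_of_ord n)) => [|x _ xr|x y].
- by rewrite inE.
- split; [by rewrite inE|exact: cycle_rel_pred|].
  by rewrite val_ord_pred ?x0 //; have := x0 x xr; lia.
rewrite !inE !andbT => /x0 xp /x0 yp.
rewrite !pred_edge // !cedge_colE /G !val_ord_pred // => E; apply: ord_inj.
by have := ltn_ord x; have := ltn_ord y; lia.
Qed.

(* The colours 0, 1, 0, 1 on the first four edges: removing any vertex strictly
   between them destroys both repetitions. *)
Definition abab_col (x : nat) : nat := if x < 2 then x else x - 2.

(** Deleting [v] removes the edges [v - 1] and [v], one of colour 0 and one of colour 1; a path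
    through 0 remains. *)
Lemma abab_remove_vertex (v : 'I_n) : 0 < v <= 3 ->
  exists F, rainbow_tree (@cycle_rel m) (cedge_col (fun i : 'I_n => abab_col i)) [set~ v] F.
Proof.
(* Parents lead to the root 0, downwards below [v] and upwards past [n - 1] above it; [rank] is the
   distance to 0 along the path. *)
move=> v13; pose par x := if x < v then ord_pred x else ordS x.
pose rank x := if x < v then x : nat else n - x.
exists [set [set x; par x] | x in [set~ v] :\ ord0].
have x0 x : x != ord0 -> 0 < x by rewrite lt0n.
have xv x : x \in [set~ v] -> x <> v :> nat by rewrite !inE => /eqP ? /ord_inj.
have parE x : x \in [set~ v] -> x != ord0 ->
    par x = (if x < v then x.-1 else if x == n.-1 :> nat then 0 else x.+1) :> nat.
  move=> _ /x0 xp; rewrite /par; case: ifP => // _; first by rewrite val_ord_pred.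
  exact: val_ordS.
have edgeE x : x \in [set~ v] :\ ord0 ->
    cedge_col abab_col [set x; par x] = abab_col (if x < v then ord_pred x else x).
  rewrite !inE => /andP[/x0 xp _]; rewrite /par; case: ifP => _.
    by rewrite pred_edge // cedge_colE.
  by rewrite -/(cedge x) cedge_colE.
apply: (rainbow_parent_tree (rank := rank)) => [|x xW xr|x y xW yW].
- by rewrite !inE -val_eqE /=; lia.
- have := parE x xW xr; have := xv x xW; have := x0 x xr; have := ltn_ord x.
  move=> ltx xp xnv pE; split.
  + by rewrite !inE -val_eqE /= pE; case: ifP; [|case: ifP]; lia.
  + by rewrite /par; case: ifP => _; rewrite ?cycle_rel_pred ?cycle_relS.
  by rewrite /rank pE; case: (ltnP x v); [|case: ifP]; case: ifP; lia.
rewrite !edgeE // /abab_col => E; apply: ord_inj; move: E.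
move: xW yW; rewrite !in_setD1 => /andP[/x0 xp /xv xn] /andP[/x0 yp /xv yn].
have := ltn_ord x; have := ltn_ord y.
by case: (ltnP x v); case: (ltnP y v); rewrite ?val_ord_pred //;
   case: ifP; case: ifP; lia.
Qed.

(** Serves the one triple for which none of 1, 2, 3 can be deleted; the edges 1 and 2 have colours 1
    and 0. *)
Lemma abab_three_vertices :
  exists F, rainbow_tree (@cycle_rel m) (cedge_col (fun i : 'I_n => abab_col i))
              [set x : 'I_n | 0 < x <= 3] F.
Proof.
set W := finset _; pose root : 'I_n := inord 1.
have rootE : root = 1 :> nat by rewrite inordK.
exists [set [set x; ord_pred x] | x in W :\ root].
have WP x : x \in W -> x != root -> 1 < x <= 3.
  by rewrite inE -val_eqE /= rootE; lia.
apply: (rainbow_parent_tree (rank := @nat_of_ord n)) => [|x xW xr|x y].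
- by rewrite inE rootE.
- have := WP x xW xr => x13; split; last by rewrite val_ord_pred; lia.
    by rewrite inE val_ord_pred; lia.
  exact: cycle_rel_pred.
rewrite !in_setD1 => /andP[xr /WP/(_ xr) x13] /andP[yr /WP/(_ yr) y13].
rewrite !pred_edge ?cedge_colE /abab_col ?val_ord_pred; try lia.
by move=> E; apply: ord_inj; move: E; case: ifP; case: ifP; lia.
Qed.

Lemma cycle_rx_upper3 :
  exists col, colouring_with (@cycle_rel m) n.-2 col /\
              k_rainbow_tree_col (@cycle_rel m) 3 col.
Proof.
exists (cedge_col (fun i : 'I_n => abab_col i)); split.
  apply: cedge_colouring => i; have := ltn_ord i; rewrite /abab_col /=.
  by case: ifP; lia.
move=> S S3.
have [[v [v13 vS]]|all] := classic (exists v : 'I_n, 0 < v <= 3 /\ v \notin S).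
  have [F tF] := abab_remove_vertex v13; exists [set~ v], F; split=> //.
  by apply/subsetP => x xS; rewrite !inE; apply: contraNneq vS => <-.
have [F tF] := abab_three_vertices; exists [set x : 'I_n | 0 < x <= 3], F.
split=> //; suff -> : [set x : 'I_n | 0 < x <= 3] = S by [].
apply/eqP; rewrite eqEcard; apply/andP; split.
  apply/subsetP => x; rewrite inE => x13; apply/negPn/negP => xS.
  by apply: all; exists x.
pose f (i : 'I_3) : 'I_n := inord i.+1.
have fE i : f i = i.+1 :> nat by rewrite inordK //; have := ltn_ord i; lia.
rewrite S3 -[leqLHS](card_ord 3) -(card_codom (f := f)); last first.
  by move=> i j /(congr1 (@nat_of_ord n)); rewrite !fE => -[] /ord_inj.
apply: subset_leq_card; apply/subsetP => _ /codomP[i ->].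
by rewrite inE fE; have := ltn_ord i; lia.
Qed.

Lemma cycle_is_rx k : 3 <= k <= n ->
  is_rx (@cycle_rel m) k (n - 1 - (k == 3)).
Proof.
move=> k3n; rewrite /is_rx; case: eqP => [|_]; first by lia.
split; last first.
  by move=> r [col [colr /(cycle_rx_lower colr k3n)]]; lia.
have [->|nk3] := eqVneq k 3.
  by rewrite subn1 subn1; exact: cycle_rx_upper3.
by rewrite subn0 subn1; exact: cycle_rx_upper_gt3.
Qed.

End CycleUpper.

Lemma gap_ge3 k N : 2 < k -> exists (T : finType) (e : rel T),
  N <= #|T| /\ [/\ k <= #|T|, simple_graph e, connected_graph e, k_cyclable e k
    & exists r c, [/\ is_rx e k r, is_crx e k c & c = r + gap k]].
Proof.
move=> k3; exists 'I_(N + k).+4, (@cycle_rel _); rewrite card_ord.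
split; first by lia.
split; [by lia|exact: cycle_rel_simple|exact: cycle_connected
  |exact: cycle_cyclable|].
exists ((N + k).+4 - 1 - (k == 3)), (N + k).+4; split.
- by apply: cycle_is_rx; lia.
- by apply: cycle_is_crx; lia.
rewrite /gap; have -> : (k == 1) = false by lia.
by case: (ltngtP k 3) k3 => // [|->] k3; lia.
Qed.

(** * Hubs joined to independent vertices *)

Section HubGraph.
Variables k' m : nat.
Local Notation k := k'.+2.
Local Notation T := ('I_k + 'I_m)%type.

Definition hub_rel : rel T := fun u v =>
  match u, v with
  | inl i, inl j => (i != j) && ((i == ord0) || (j == ord0))
  | inr _, inr _ => false
  | _, _ => true
  end.

Lemma hub_rel_sym : symmetric hub_rel.
Proof. by move=> [i|i] [j|j] //=; rewrite eq_sym orbC. Qed.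

Lemma hub_simple : simple_graph hub_rel.
Proof. by split=> [|[i|i]] //=; [exact: hub_rel_sym|rewrite eqxx]. Qed.

Lemma hub_connected : connected_graph hub_rel.
Proof.
have c0 u : connect hub_rel u (inl ord0).
  case: u => [i|i]; last exact: connect1.
  have [->|ni] := eqVneq i ord0; first exact: connect0.
  by apply: connect1; rewrite /= ni eqxx orbT.
move=> u v; apply: connect_trans (c0 u) _.
by rewrite (sym_connect_sym hub_rel_sym).
Qed.

Section Alternate.
Variable a : 'I_k -> 'I_m.
Hypothesis a_inj : injective a.

Definition alternate (s : seq 'I_k) : seq T :=
  flatten [seq [:: inl i; inr (a i)] | i <- s].

Lemma size_alternate s : size (alternate s) = (size s).*2.
Proof. by elim: s => //= j s ->. Qed.

Lemma mem_alternate_inl s i : ((inl i : T) \in alternate s) = (i \in s).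
Proof. by elim: s => //= j s IH; rewrite !inE IH. Qed.

Lemma mem_alternate_inr s i : ((inr (a i) : T) \in alternate s) = (i \in s).
Proof. by elim: s => //= j s IH; rewrite !inE IH /= (inj_eq inr_inj) inj_eq. Qed.

Lemma alternate_uniq s : uniq s -> uniq (alternate s).
Proof.
elim: s => //= j s IH /andP[js Us].
by rewrite !inE mem_alternate_inl mem_alternate_inr IH ?js.
Qed.

Lemma alternate_path j i s : path hub_rel (inr j) (rcons (alternate s) (inl i)).
Proof. by elim: s j => //= h s IH j; exact: IH. Qed.

Lemma alternate_cycle : is_cycle hub_rel (alternate (enum 'I_k)).
Proof.
rewrite /is_cycle alternate_uniq ?enum_uniq //=.
apply/andP; split.
  by rewrite size_alternate size_enum_ord.
by rewrite enum_ordSl /=; exact: alternate_path.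
Qed.

End Alternate.

(** The independent vertices of [S] are completed to [k] of them, which alternate with all [k] hubs
    on a cycle containing [S]. *)
Lemma hub_cyclable : k <= m -> k_cyclable hub_rel k.
Proof.
move=> km S Sk; pose A0 := [set j : 'I_m | inr j \in S].
have [|A sA0 Ak] := @set_extend _ A0 k.
  rewrite card_ord km andbT -Sk -(card_imset _ (@inr_inj 'I_k 'I_m)).
  apply: subset_leq_card; apply/subsetP => _ /imsetP[j + ->].
  by rewrite inE.
have sA : size (enum A) = k by rewrite -cardE.
pose a (i : 'I_k) := nth (widen_ord km i) (enum A) i.
have aE j0 (i : 'I_k) : a i = nth j0 (enum A) i.
  by apply: set_nth_default; rewrite sA.
have a_inj : injective a.
  move=> i j; rewrite (aE (a i) i) (aE (a i) j) => /eqP.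
  by rewrite nth_uniq ?enum_uniq ?sA // => /eqP/ord_inj.
exists (alternate a (enum 'I_k)); split; first exact: alternate_cycle.
case=> [i|j] xS; first by rewrite mem_alternate_inl mem_enum.
have jA : j \in enum A by rewrite mem_enum (subsetP sA0) // inE.
have lti : index j (enum A) < k by rewrite -sA index_mem.
have <- : a (Ordinal lti) = j by rewrite (aE j) nth_index.
by rewrite mem_alternate_inr // mem_enum.
Qed.

(** On a star edge one of [i], [j] is 0 and the other positive, so its colour is at least [k], above
    the colours [0] to [k - 1] of hub-vertex edges. *)
Definition hub_col (u v : T) : nat :=
  match u, v with
  | inl i, inl j => k.-1 + (i + j)
  | inl i, inr _ | inr _, inl i => i
  | inr _, inr _ => 0
  end.

Lemma hub_colC u v : hub_col u v = hub_col v u.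
Proof. by case: u v => [i|i] [j|j] //=; rewrite (addnC (nat_of_ord i)). Qed.

(** The tree is the star of hubs with each independent vertex of [S] hung on the hub given by its
    position in [enum S]; distinct positions give distinct colours. *)
Lemma hub_rainbow_tree_col : k_rainbow_tree_col hub_rel k (edge_col hub_col).
Proof.
move=> S Sk; pose W := [set u | if u is inl _ then true else u \in S].
pose hub u : 'I_k := inord (index u (enum S)).
pose par u : T := if u is inl _ then inl ord0 else inl (hub u).
pose rank (u : T) := match u with inl i => (i != ord0) : nat | _ => 2 end.
have hubE u : u \in S -> hub u = index u (enum S) :> nat.
  move=> uS; rewrite inordK //; apply: leq_trans (eq_leq Sk).
  by rewrite cardE index_mem mem_enum.
exists W, [set [set u; par u] | u in W :\ inl ord0]; split; last first.
  by apply/subsetP => -[i|j] uS; rewrite inE.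
apply: (rainbow_parent_tree (rank := rank)) => [|[i|j] uW ur|u v].
- by rewrite inE.
- have ni : i != ord0 by [].
  by split; rewrite ?inE //= ?ni ?eqxx ?orbT.
- by split; rewrite ?inE //=; case: eqP.
rewrite !edge_colE; try exact: hub_colC.
rewrite !in_setD1 => /andP[nu uW] /andP[nv vW].
case: u nu uW => [i|i] nu uW; case: v nv vW => [j|j] nv vW /=.
- by move=> E; congr inl; apply: ord_inj; lia.
- have : 0 < i by rewrite lt0n; apply: contraNneq nu => i0; apply/eqP; congr inl; exact: ord_inj.
  by move=> i0 E; exfalso; have := ltn_ord (hub (inr j)); rewrite -E; clear -i0; lia.
- have : 0 < j by rewrite lt0n; apply: contraNneq nv => i0; apply/eqP; congr inl; exact: ord_inj.
  by move=> j0 E; exfalso; have := ltn_ord (hub (inr i)); rewrite E; clear -j0; lia.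
rewrite !inE in uW vW.
rewrite !hubE // => E.
by apply: (@index_inj _ (inr i) (enum S)); rewrite ?mem_enum.
Qed.

Lemma hub_ex_is_rx : exists2 r, is_rx hub_rel k r & r <= k ^ 2 - 1.
Proof.
have [|r rP le_r] := @ex_is_min (fun r => exists col, colouring_with hub_rel r col /\
          k_rainbow_tree_col hub_rel k col) (2 * k - 1).
- exists (edge_col hub_col); split; last exact: hub_rainbow_tree_col.
  move=> u v; rewrite edge_colE; last exact: hub_colC.
  case: u v => [i|i] [j|j] //=; try (by have := ltn_ord i; have := ltn_ord j; lia).
  by move=> /andP[_ /orP[]/eqP->] /=; have := ltn_ord i; have := ltn_ord j; lia.
(* [2 * k - 1 <= k ^ 2 - 1] because [k >= 2]. *)
by exists r => //; apply: leq_trans le_r _; nia.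
Qed.

(* Among many independent vertices, [k] send the same colours to all hubs. On a
   cycle through them every hub follows one of them and precedes another, so two
   edges at that hub share a colour. *)
Lemma hub_crx_lower c r : 0 < c -> k * c ^ k <= m -> is_crx hub_rel k r -> c <= r.
Proof.
move=> c0 lem [[col [colr colc]] _]; rewrite leqNgt; apply/negP => lt_rc.
have cc i j : col [set inl i; inr j] < c.
  by apply: leq_trans (colr (inl i) (inr j) isT) _; exact: ltnW.
pose vec (j : 'I_m) : {ffun 'I_k -> 'I_c} := [ffun i => Ordinal (cc i j)].
(* There are [c ^ k] colour vectors, and [m] exceeds [(k - 1) * c ^ k]. *)
have [v kv] : exists v, k <= #|[set j | vec j == v]|.
  apply: NNPP => nv.
  have lt_v v : #|[set j | vec j == v]| <= k.-1.
    by rewrite leqNgt; apply/negP => kv; apply: nv; exists v.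
  have : #|'I_m| <= \sum_(v : {ffun 'I_k -> 'I_c}) k.-1.
    rewrite -sum1_card (partition_big vec xpredT) //=.
    apply: leq_sum => v _; apply: leq_trans (lt_v v).
    by rewrite -sum1dep_card.
  rewrite sum_nat_const card_ffun !card_ord.
  have := expn_gt0 c k; rewrite c0 /=.
  by move: (c ^ k) lem => N /=; nia.
have [B sB Bk] : exists2 B : {set 'I_m}, B \subset [set j | vec j == v] & #|B| = k.
  have [B] : exists B, B \in [set B : {set 'I_m} | B \subset [set j | vec j == v] & #|B| == k].
    apply/card_gt0P; by rewrite cards_draws bin_gt0.
  by rewrite inE => /andP[sB /eqP Bk]; exists B.
have colB i j : j \in B -> col [set inl i; inr j] = v i.
  by move=> /(subsetP sB); rewrite inE => /eqP<-; rewrite ffunE.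
have [p [/andP[cp Ucol] sp]] : exists p, rainbow_cycle hub_rel col p /\
    {subset (@inr 'I_k 'I_m) @: B <= p}.
  by apply: colc; rewrite card_imset //; exact: inr_inj.
have /and3P[Up _ cyc] := cp.
have Bp j : j \in B -> inr j \in p by move=> jB; apply: sp; exact: imset_f.
(* The default [ord0] is never taken on [B], since independent vertices have only hubs as
   neighbours. *)
pose nx j : 'I_k := if next p (inr j) is inl i then i else ord0.
have nxE j : j \in B -> next p (inr j) = inl (nx j).
  by move=> /Bp/(next_cycle cyc); rewrite /nx; case: (next p _).
have nx_inj : {in B &, injective nx}.
  move=> i j iB jB E; apply: (@inr_inj 'I_k); apply: (can_inj (prev_next Up)).
  by rewrite !nxE // E.
have nx_surj i : exists2 j, j \in B & i = nx j.
  have /eqP E : nx @: B == [set: 'I_k].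
    by rewrite eqEcard subsetT cardsT card_ord (card_in_imset nx_inj) Bk /=.
  by have : i \in nx @: B; [rewrite E inE|case/imsetP=> j; exists j].
have [y yB] : exists y, y \in B by apply/card_gt0P; rewrite Bk.
have yp := Bp y yB.
have [h Eh] : exists h, prev p (inr y) = inl h.
  by have := prev_cycle cyc yp; case: (prev p _) => // h; exists h.
have [x xB hx] := nx_surj h.
have hp : inl h \in p by rewrite -Eh mem_prev.
have Uc : {in p &, injective (fun u => col [set u; next p u])}.
  move: Ucol; rewrite cycle_edgesE // -map_comp => Ucol u u' up u'p E.
  by apply: (@index_inj _ u p) => //; apply/eqP;
     rewrite -(nth_uniq 0 _ _ Ucol) ?size_map ?index_mem // !(nth_map u) ?index_mem // !nth_index //=; apply/eqP.
(* The edges leaving [inr x] and [inl h] both have colour [v h], so a rainbow cycle would identify a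
   vertex with a hub. *)
have : inr x = inl h :> T; last by [].
apply: Uc => //; first exact: Bp.
by rewrite nxE // -hx setUC colB // -Eh next_prev // Eh colB.
Qed.

End HubGraph.

(** * Bounded rainbow index with large rainbow cycle index, and conclusion *)

Lemma arbitrarily_large_crx k c : 0 < k -> 0 < c -> exists (T : finType) (e : rel T),
  [/\ k <= #|T|, simple_graph e, connected_graph e, k_cyclable e k &
    exists r c', [/\ is_rx e k r, is_crx e k c', r <= k ^ 2 - 1 & c <= c']].
Proof.
case: k => [//|[|k]] _ c0.
  (* For [k = 1] the bound [k ^ 2 - 1] is 0 and is met by convention, so a long cycle will do. *)
  exists 'I_c.+4, (@cycle_rel _); rewrite card_ord.
  split=> //; [exact: cycle_rel_simple|exact: cycle_connected|exact: cycle_cyclable|].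
  by exists 0, c.+4; split=> //; [exact: cycle_is_crx|lia].
pose m := k.+2 * c ^ k.+2.
have km : k.+2 <= m by rewrite /m leq_pmulr // expn_gt0 c0.
exists ('I_k.+2 + 'I_m)%type, (@hub_rel k m).
split; [by rewrite card_sum !card_ord leq_addr|exact: hub_simple
  |exact: hub_connected|exact: hub_cyclable|].
have [r rP le_r] := @hub_ex_is_rx k m.
have [c' c'P] := ex_is_crx (hub_cyclable km).
by exists r, c'; split=> //; apply: hub_crx_lower c'P.
Qed.

Theorem theorem2p7 (k : nat) (hk : 1 <= k) :
  (* (a) infinitely many such graphs: arbitrarily large ones *)
  (forall N : nat, exists (T : finType) (e : rel T),
      N <= #|T| /\ [/\ k <= #|T|, simple_graph e, connected_graph e, k_cyclable e k &
          exists r c, [/\ is_rx e k r, is_crx e k c & c = r + gap k]])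
  /\
  (* (b) *)
  (forall c : nat, 1 <= c -> exists (T : finType) (e : rel T),
      [/\ k <= #|T|, simple_graph e, connected_graph e, k_cyclable e k &
          exists r c', [/\ is_rx e k r, is_crx e k c', r <= k ^ 2 - 1 & c <= c']]).
Proof.
split=> [N|c c0]; last exact: arbitrarily_large_crx.
by have [k2|k3] := leqP k 2; [apply: gap_le2; rewrite hk|exact: gap_ge3].
Qed.
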